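(* There is an absolute constant $c>0$ such that the following holds. Let $k=k(n)$ be a real-valued function with $k(n)\ge 1$ and $k(n)=o(n^{1/2})$ as $n\to\infty$. Then for all sufficiently large $n$ (depending on the function $k$), every $n$-vertex graph $G$ with $e(G)\ge n^2/k$ contains an edge set $F\subseteq E(G)$ with $$|F|\ge c\,\frac{n^2}{k^3}$$ that is ambiently strongly $C_6$-connected in $G$.
   Context: All graphs are finite and simple; $e(G)$ is the number of edges. A cycle is a simple cycle, not necessarily induced. An edge set $F\subseteq E(G)$ is ambiently strongly $C_6$-connected in $G$ if every two distinct edges of $F$ lie together on a cycle of length at most $6$ in $G$, and every two adjacent distinct edges of $F$ (edges sharing an endpoint) lie together on a $C_4$ (cycle of length $4$) in $G$. The witness cycles are allowed to use edges outside $F$. *)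

(* Defs.v *)
From mathcomp Require Import all_boot all_order all_algebra.
From mathcomp Require Import all_classical all_reals all_analysis.

Set Implicit Arguments.
Unset Strict Implicit.
Unset Printing Implicit Defensive.

Section Graphs.
Variables (T : finType) (e : rel T).

(* A simple graph on T is a symmetric irreflexive relation e; an edge is the
   two-element set of its endpoints, so each edge is counted once. *)
Definition simple_graph : Prop := symmetric e /\ irreflexive e.

Definition edges : {set {set T}} :=
  [set [set p.1; p.2] | p : T * T & e p.1 p.2].

(* The length bound excludes the degenerate closed walks x, y, x of [ucycle]. *)
Definition is_cycle (s : seq T) : Prop := ucycle e s /\ 2 < size s.

Definition cycle_edges (s : seq T) : {set {set T}} :=
  [set [set x; next s x] | x in s].

Definition on_common_cycle (L : pred nat) (f g : {set T}) : Prop :=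
  exists s : seq T,
    [/\ is_cycle s, L (size s), f \in cycle_edges s & g \in cycle_edges s].

Definition adjacent_edges (f g : {set T}) : Prop :=
  exists x : T, x \in f /\ x \in g.

Definition ambiently_strongly_C6_connected (F : {set {set T}}) : Prop :=
  [/\ F \subset edges,
      forall f g : {set T}, f \in F -> g \in F -> f != g ->
        on_common_cycle (fun l => l <= 6) f g
    & forall f g : {set T}, f \in F -> g \in F -> f != g ->
        adjacent_edges f g -> on_common_cycle (fun l => l == 4) f g].

End Graphs.

(* Main.v *)
Require Import Defs.
From mathcomp Require Import all_boot all_order all_algebra.
From mathcomp Require Import all_classical all_reals all_analysis.
From mathcomp Require Import zify ring.
Import Order.TTheory GRing.Theory Num.Theory.
Import numFieldNormedType.Exports.

Set Implicit Arguments.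
Unset Strict Implicit.
Unset Printing Implicit Defensive.

(** Call the arcs [(u, v)] with [u] a neighbour of [x] and [v] a neighbour of
    [y] the link of [(x, y)].  Two disjoint link edges [uv], [u'v'] lie on the
    6-cycle [u v y v' u' x]; link edges [uv], [uv'] lie on the 4-cycle
    [v u v' y], and symmetrically for [uv], [u'v] with [x].  So the link is
    ambiently strongly C6-connected as soon as the tails of its arcs avoid the
    heads, which a random vertex set cutting the arcs ensures at the cost of a
    factor 4.  Links are in bijection with 3-paths: with [m] edges on [n]
    vertices at least [m / 2] arcs have both endpoints of degree at least
    [m / (4n)], which gives of order [m^3 / n^2] such paths, hence a pair
    [(x, y)] whose link has of order [m^3 / n^4] arcs. *)

Local Open Scope nat_scope.

(** A maximiser of [f] is at least the average; the bound is multiplied out to avoid division in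
    [nat]. *)
Lemma sum_witness (I : finType) (f : I -> nat) (w : nat) :
  0 < #|I| -> w <= \sum_i f i -> exists i, w <= #|I| * f i.
Proof.
move=> /card_gt0P [i0 _] le_w.
have [i _ max_i] := arg_maxnP f (erefl (xpredT i0)).
exists i; apply: leq_trans le_w _.
rewrite -sum_nat_const; apply: leq_sum => j _; exact: max_i.
Qed.

(** * Averaging over vertex cuts *)

Section Cut.
Variable T : finType.

(** Adding [u] is injective on the subsets of the complement of [{u, v}], which are a quarter of all
    vertex sets, and yields sets separating [u] from [v]. *)
Lemma card_separating_sets (u v : T) :
  u != v -> 2 ^ #|T| <= 4 * #|[set A : {set T} | (u \in A) && (v \notin A)]|.
Proof.
move=> uv; set B := ~: [set u; v].
have cardB : #|T| = #|B| + 2 by rewrite -(cardsC [set u; v]) cards2 uv addnC.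
rewrite cardB expnD mulnC leq_mul2l /= -card_powerset.
rewrite -(card_in_imset (f := fun A => u |: A)).
  apply/subset_leq_card/fintype.subsetP => _ /imsetP [A + ->].
  rewrite powersetE => /fintype.subsetP sAB.
  rewrite !inE eqxx /= negb_or eq_sym uv /=.
  by apply/negP => /sAB; rewrite !inE eqxx orbT.
move=> A A'; rewrite !powersetE => sA sA' eqA.
have uN (C : {set T}) : C \subset B -> u \notin C.
  by move=> /fintype.subsetP sC; apply/negP => /sC; rewrite !inE eqxx.
by rewrite -(setU1K (uN A sA)) eqA setU1K // uN.
Qed.

(** Count pairs of a vertex set and an arc that it cuts: each arc is cut by at least a quarter of
    all sets, so some set cuts at least a quarter of the arcs. *)
Lemma large_directed_cut (P : {set T * T}) :
  (forall p, p \in P -> p.1 != p.2) ->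
  exists A : {set T},
    #|P| <= 4 * #|[set p in P | (p.1 \in A) && (p.2 \notin A)]|.
Proof.
move=> irrP.
pose f (A : {set T}) := #|[set p in P | (p.1 \in A) && (p.2 \notin A)]|.
have card_pow : #|{set T}| = 2 ^ #|T|.
  rewrite -[in RHS]cardsT -card_powerset; apply: eq_card => A.
  by rewrite powersetE finset.subsetT.
have sum_f : \sum_A f A =
    \sum_(p in P) #|[set A : {set T} | (p.1 \in A) && (p.2 \notin A)]|.
  under eq_bigr => A _ do rewrite /f -sum1dep_card big_mkcondr /=.
  rewrite exchange_big /=; apply: eq_bigr => p _.
  by rewrite -sum1dep_card -big_mkcond.
have [A] : exists A, #|P| * 2 ^ #|T| <= #|{set T}| * (4 * f A).
  apply: sum_witness; first by rewrite card_pow expn_gt0.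
  rewrite -big_distrr /= sum_f big_distrr /= -sum_nat_const.
  by apply: leq_sum => p /irrP; apply: card_separating_sets.
rewrite card_pow mulnC leq_pmul2l ?expn_gt0 // => le_A.
by exists A.
Qed.

End Cut.

(** * Short cycles through two edges of a link *)

Section Graph.
Variables (T : finType) (e : rel T).
Hypothesis e_simple : simple_graph e.

Let e_sym : symmetric e := e_simple.1.
Let e_irr : irreflexive e := e_simple.2.

Lemma edge_neq (u v : T) : e u v -> u != v.
Proof. by apply: contraTneq => ->; rewrite e_irr. Qed.

Lemma common_C4 (a b c d : T) :
  e a b -> e b c -> e c d -> e d a -> a != c -> b != d ->
  on_common_cycle e (fun l => l == 4) [set a; b] [set b; c].
Proof.
move=> ab bc cd da ac bd; exists [:: a; b; c; d].
have [[[nab nbc] ncd] nda] := (edge_neq ab, edge_neq bc, edge_neq cd, edge_neq da).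
split=> //.
- split=> //; rewrite /ucycle /= ab bc cd da /= !inE !negb_or.
  by rewrite nab ac (eq_sym a d) nda nbc bd ncd.
- by apply/imsetP; exists a; rewrite ?inE ?eqxx //= eqxx.
- apply/imsetP; exists b; rewrite ?inE ?eqxx ?orbT //=.
  by rewrite (eq_sym b a) (negbTE nab) eqxx.
Qed.

Lemma on_common_cycleW (L L' : pred nat) (f g : {set T}) :
  (forall l, L l -> L' l) ->
  on_common_cycle e L f g -> on_common_cycle e L' f g.
Proof. by move=> LL' [s [? /LL' ? ? ?]]; exists s. Qed.

(** For [x != y] and irreflexive [e], these are the middle arcs of the paths with three edges from
    [x] to [y], oriented from [x] towards [y]. *)
Definition link (x y : T) : {set T * T} :=
  [set p | [&& e x p.1, e p.1 p.2, e p.2 y, x != p.2 & y != p.1]].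

Lemma link_connected (x y : T) (A : {set T}) : x != y ->
  ambiently_strongly_C6_connected e
    [set [set p.1; p.2] | p in
       [set p in link x y | (p.1 \in A) && (p.2 \notin A)]].
Proof.
move=> xy; set Q := [set p in _ | _].
have QP p : p \in Q -> [/\ e x p.1, e p.1 p.2 & e p.2 y] /\
    [/\ x != p.2, y != p.1, p.1 \in A & p.2 \notin A].
  by rewrite !inE => /andP [/and5P [? ? ? ? ?] /andP [? ?]].
(* Tails lie in [A] and heads outside, so two edges can only meet tail to tail or head to head. *)
have cross p q : p \in Q -> q \in Q -> p.1 != q.2.
  move=> /QP [_ [_ _ pA _]] /QP [_ [_ _ _ qA]].
  by apply: contraNneq qA => <-.
have C4 p q : p \in Q -> q \in Q -> [set p.1; p.2] != [set q.1; q.2] ->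
    p.1 = q.1 \/ p.2 = q.2 ->
    on_common_cycle e (fun l => l == 4) [set p.1; p.2] [set q.1; q.2].
  move=> /QP [[xp1 pp p2y] [xp2 yp1 _ _]] /QP [[xq1 qq q2y] [xq2 yq1 _ _]].
  move=> + pq; case: pq => pq; rewrite -pq => npq.
    rewrite (finset.setUC [set p.1] [set p.2]); apply: (@common_C4 _ _ _ y).
    + by rewrite e_sym.
    + by rewrite pq.
    + by [].
    + by rewrite e_sym.
    + by apply: contraNneq npq => ->.
    + by rewrite eq_sym.
  rewrite (finset.setUC [set q.1] [set p.2]); apply: (@common_C4 _ _ _ x) => //.
  + by rewrite pq e_sym.
  + by rewrite e_sym.
  + by apply: contraNneq npq => ->.
  + by rewrite eq_sym.
split.
- apply/fintype.subsetP => _ /imsetP [p /QP [[_ pp _] _] ->].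
  by apply/imsetP; exists p; rewrite ?inE.
- move=> _ _ /imsetP [p pQ ->] /imsetP [q qQ ->] neq.
  have [pq1|npq1] := eqVneq p.1 q.1.
    apply: on_common_cycleW (C4 p q pQ qQ neq (or_introl pq1)).
    by move=> l /eqP ->.
  have [pq2|npq2] := eqVneq p.2 q.2.
    apply: on_common_cycleW (C4 p q pQ qQ neq (or_intror pq2)).
    by move=> l /eqP ->.
  have [npq npp] := (cross p q pQ qQ, cross p p pQ pQ).
  have [nqp nqq] := (cross q p qQ pQ, cross q q qQ qQ).
  have [[xp1 pp p2y] [xp2 yp1 _ _]] := QP _ pQ.
  have [[xq1 qq q2y] [xq2 yq1 _ _]] := QP _ qQ.
  have [nxp nxq] := (edge_neq xp1, edge_neq xq1).
  have [npy nqy] := (edge_neq p2y, edge_neq q2y).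
  (* Tails and heads now differ, so the six vertices are distinct; the edge of [q] is traversed from
     head to tail. *)
  exists [:: p.1; p.2; y; q.2; q.1; x]; split=> //.
  + split=> //; rewrite /ucycle /= pp p2y (e_sym y) q2y (e_sym q.2) qq.
    rewrite (e_sym q.1) xq1 xp1 /= !inE !negb_or npp (eq_sym p.1 y) yp1 npq npq1.
    rewrite (eq_sym p.1 x) nxp npy npq2 (eq_sym p.2 q.1) nqp (eq_sym p.2 x) xp2.
    rewrite (eq_sym y q.2) nqy yq1 (eq_sym y x) xy (eq_sym q.2 q.1) nqq.
    by rewrite (eq_sym q.2 x) xq2 (eq_sym q.1 x) nxq.
  + by apply/imsetP; exists p.1; rewrite ?inE ?eqxx //= eqxx.
  + apply/imsetP; exists q.2; rewrite ?inE ?eqxx ?orbT //=.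
    rewrite !(eq_sym q.2) (negbTE npq) (negbTE npq2) (eq_sym y) (negbTE nqy) eqxx.
    by rewrite finset.setUC.
- move=> _ _ /imsetP [p pQ ->] /imsetP [q qQ ->] npq [z []].
  have [ncr nrc] := (cross p q pQ qQ, cross q p qQ pQ).
  rewrite !inE => /orP [] /eqP -> /orP [] /eqP pq.
  + by apply: C4 => //; left.
  + by rewrite pq eqxx in ncr.
  + by rewrite pq eqxx in nrc.
  + by apply: C4 => //; right.
Qed.

(** * Counting paths with three edges *)

Definition deg (u : T) : nat := #|[set v | e u v]|.

Definition arcs : {set T * T} := [set p | e p.1 p.2].

Lemma card_edges_le_arcs : #|edges e| <= #|arcs|.
Proof.
apply: leq_trans (leq_imset_card (fun p : T * T => [set p.1; p.2]) arcs).
by apply: subset_leq_card; apply/fintype.subsetP => _ /imsetP [p pe ->];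
  apply/imsetP; exists p.
Qed.

Definition low (m : nat) (u : T) : bool := 4 * #|T| * deg u < m.

Lemma card_low_arcs (m : nat) :
  4 * #|[set p in arcs | low m p.1]| <= m.
Proof.
have [T0|T_gt0] := posnP #|T|.
  rewrite [X in 4 * X]eq_card0 // => p.
  by have := card0_eq T0 p.1; rewrite inE.
have -> : #|[set p in arcs | low m p.1]| = \sum_(u | low m u) deg u.
  under [RHS]eq_bigr => u _ do rewrite /deg -sum1dep_card.
  rewrite pair_big_dep /= -sum1dep_card; apply: eq_bigl => p.
  by rewrite inE andbC.
rewrite -(leq_pmul2l T_gt0) mulnA (mulnC #|T| 4) big_distrr /=.
apply: leq_trans (_ : \sum_(u : T) m <= _); last by rewrite sum_nat_const.
rewrite big_mkcond /=; apply: leq_sum => u _.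
by case: ifP => // /ltnW.
Qed.

Definition good_arcs (m : nat) : {set T * T} :=
  [set p in arcs | ~~ low m p.1 && ~~ low m p.2].

(** Of at least [m] arcs, at most [m / 4] have a low tail and, by reversing arcs, at most [m / 4]
    have a low head. *)
Lemma card_good_arcs : #|edges e| <= 2 * #|good_arcs #|edges e| |.
Proof.
set m := #|edges e|.
have low1 := card_low_arcs m.
have low2 : 4 * #|[set p in arcs | low m p.2]| <= m.
  suff -> : #|[set p in arcs | low m p.2]| = #|[set p in arcs | low m p.1]|.
    by [].
  have swap_inj : injective (fun p : T * T => (p.2, p.1)).
    by move=> [a b] [c d] [-> ->].
  rewrite -(card_imset _ swap_inj); apply: eq_card => -[u v].
  apply/imsetP/idP => [[[a b]]|]; rewrite !inE /=.
    by rewrite e_sym => pe [-> ->].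
  by rewrite e_sym => pe; exists (v, u); rewrite ?inE.
have cover : #|arcs| <= #|good_arcs m| +
    (#|[set p in arcs | low m p.1]| + #|[set p in arcs | low m p.2]|).
  apply: leq_trans (leq_add (leqnn _) (leq_card_setU _ _)).
  apply: leq_trans (leq_card_setU _ _).
  apply/subset_leq_card/fintype.subsetP => p.
  by rewrite !inE => ->; case: (low m p.1); case: (low m p.2).
have := card_edges_le_arcs; rewrite -/m; lia.
Qed.

(** For an arc [(u, v)], the pairs of ends of the 3-paths with this middle arc; the counterpart of
    [link], which fixes the ends instead. *)
Definition extensions (u v : T) : {set T * T} :=
  [set q | [&& e q.1 u, e v q.2, q.1 != v, q.2 != u & q.1 != q.2]].

Lemma card_extensions (u v : T) :
  (deg u - 1) * (deg v - 2) <= #|extensions u v|.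
Proof.
have -> : #|extensions u v| = \sum_(x | e u x && (x != v))
    #|[set y | e v y] :\: [set u; x]|.
  under [RHS]eq_bigr => x _ do rewrite -sum1_card.
  rewrite pair_big_dep /= -sum1dep_card; apply: eq_bigl => -[x y].
  rewrite !inE /= negb_or (e_sym x) (eq_sym y x).
  by case: (e u x); case: (e v y); case: (x == v); case: (y == u); case: (x == y).
apply: leq_trans (_ : \sum_(x | e u x && (x != v)) (deg v - 2) <= _); last first.
  apply: leq_sum => x _; rewrite cardsD leq_sub2l //.
  apply: leq_trans (subset_leq_card (subsetIr _ _)) _.
  by rewrite cards2; case: (u != x).
rewrite sum_nat_const leq_mul2r; apply/orP; right.
have -> : #|[pred x | e u x && (x != v)]| = #|[set x | e u x] :\ v|.
  by apply: eq_card => x; rewrite !inE andbC.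
by rewrite /deg (cardsD1 v [set x | e u x]); case: (v \in _); lia.
Qed.

(** Both degrees are at least [m / (4 * #|T|)], hence at least 4, so subtracting 2 at most halves
    them. This gives two factors [m / (8 * #|T|)]. *)
Lemma card_extensions_good (m : nat) (p : T * T) :
  0 < #|T| -> 16 * #|T| <= m -> p \in good_arcs m ->
  m ^ 2 <= 64 * #|T| ^ 2 * #|extensions p.1 p.2|.
Proof.
move=> T_gt0 m_large; rewrite !inE /low -!leqNgt => /and3P [_ d1 d2].
have half (d : nat) : m <= 4 * #|T| * d -> m <= 8 * #|T| * (d - 2).
  move=> le_m; apply: (leq_trans le_m).
  have : 4 <= d by rewrite -(leq_pmul2l (isT : 0 < 4)) -(leq_pmul2l T_gt0); lia.
  move=> d_ge4; apply: leq_trans (_ : 4 * #|T| * (2 * (d - 2)) <= _); last by lia.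
  by rewrite leq_mul2l; lia.
apply: leq_trans (leq_mul (leqnn _) (card_extensions p.1 p.2)).
apply: leq_trans (leq_mul (half _ d1) (half _ d2)) _.
rewrite (_ : 64 = 8 * 8) // -mulnn (mulnACA 8) mulnACA.
by rewrite leq_mul2l leq_mul2r leq_sub2l ?orbT.
Qed.

(** Count 3-paths by middle arc and by pair of ends. The constant is 2 from the good arcs times 64
    from their extensions; averaging over the pairs costs [#|T| ^ 2]. *)
Lemma large_link : 0 < #|T| -> 16 * #|T| <= #|edges e| ->
  exists x y : T, x != y /\
    #|edges e| ^ 3 <= 128 * #|T| ^ 4 * #|link x y|.
Proof.
set m := #|edges e| => T_gt0 m_large.
(* With weight 0 on the diagonal, the pair found by averaging has [x != y], since [m] is
   positive. *)
pose f (q : T * T) := if q.1 != q.2 then #|link q.1 q.2| else 0.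
have sum_f : \sum_(p in arcs) #|extensions p.1 p.2| = \sum_q f q.
  under eq_bigr => p _ do rewrite -sum1dep_card.
  rewrite (exchange_big_dep xpredT) //=; apply: eq_bigr => q _.
  rewrite /f; case: ifP => q12.
    rewrite -sum1dep_card; apply: eq_bigl => p; rewrite !inE.
    by rewrite andbT; case: (e p.1 p.2); rewrite ?andbF ?andbT //=.
  by rewrite big_pred0 // => p; rewrite !andbF.
have le_sum : m ^ 3 <= \sum_q 128 * #|T| ^ 2 * f q.
  rewrite -big_distrr -sum_f /= expnS.
  apply: leq_trans (leq_mul card_good_arcs (leqnn _)) _.
  rewrite -/m (_ : 128 = 2 * 64) // -!(mulnA 2) leq_mul2l /= -sum_nat_const.
  rewrite big_distrr /= [leqRHS](bigID (fun p => p \in good_arcs m)) /=.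
  apply: leq_trans (leq_addr _ _).
  rewrite [leqRHS](eq_bigl (fun p => p \in good_arcs m)).
    by apply: leq_sum => p; apply: card_extensions_good.
  by move=> p; rewrite !inE; case: (e _ _).
have TT_gt0 : 0 < #|{: T * T}| by rewrite card_prod muln_gt0 T_gt0.
have [[x y]] := sum_witness TT_gt0 le_sum.
rewrite card_prod /f /=; case: ifP => [xy le_m|_]; last first.
  by rewrite !muln0 leqn0 expn_eq0; lia.
by exists x, y; split=> //; apply: leq_trans le_m _; lia.
Qed.

Lemma connected_edge_set : 0 < #|T| -> 16 * #|T| <= #|edges e| ->
  exists F : {set {set T}}, ambiently_strongly_C6_connected e F /\
    #|edges e| ^ 3 <= 512 * #|T| ^ 4 * #|F|.
Proof.
move=> T_gt0 m_large; have [x [y [xy le_link]]] := large_link T_gt0 m_large.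
have [p|A le_cut] := @large_directed_cut T (link x y).
  by rewrite inE => /and5P [_ /edge_neq].
exists [set [set p.1; p.2] | p in
   [set p in link x y | (p.1 \in A) && (p.2 \notin A)]].
split; first exact: link_connected.
rewrite [X in _ * X]card_in_imset.
  apply: leq_trans le_link _.
  apply: leq_trans (leq_mul (leqnn _) le_cut) _.
  by rewrite mulnA (mulnAC 128).
(* Forgetting the orientation loses no arcs: the tail is the endpoint lying in [A]. *)
move=> [a b] [a' b'] /setIdP [_ /andP /= [aA bA]] /setIdP [_ /andP /= [aA' bA']].
move=> /setP eq_ab.
have := eq_ab a; rewrite !inE eqxx /= => /esym /orP [] /eqP ?; last first.
  by subst; rewrite aA in bA'.
have := eq_ab b; rewrite !inE eqxx orbT => /esym /orP [] /eqP ?.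
  by subst; rewrite aA' in bA.
by subst.
Qed.

End Graph.

(** * The asymptotic statement *)

Local Open Scope classical_set_scope.
Local Open Scope ring_scope.

Theorem theorem1p3 (R : realType) :
  exists2 c : R, 0 < c &
    forall k : nat -> R,
      (forall n : nat, 1 <= k n) ->
      k =o_\oo (fun n : nat => Num.sqrt (n%:R : R)) ->
      \forall n \near \oo,
        forall (T : finType) (e : rel T),
          simple_graph e ->
          #|T| = n ->
          n%:R ^+ 2 / k n <= #|edges e|%:R ->
          exists F : {set {set T}},
            ambiently_strongly_C6_connected e F /\
            c * (n%:R ^+ 2 / k n ^+ 3) <= #|F|%:R.
Proof.
exists 512^-1; first by rewrite invr_gt0.
move=> k k_ge1 /eqoP k_o.
(* Little-o is used only as [k n <= sqrt n] eventually. With [n >= 256], so that [sqrt n >= 16], it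
   gives [16 * k n <= n], hence at least [16 * n] edges. *)
have := k_o 1 ltr01; apply: filterS2 (nbhs_infty_ge 256) => n /= n_large k_le.
move=> T e e_simple cardT m_large.
have k_gt0 : 0 < k n by apply: lt_le_trans (k_ge1 n).
have n_gt0 : 0 < n%:R :> R by rewrite ltr0n; lia.
have k_le_sqrt : k n <= Num.sqrt n%:R.
  by move: k_le; rewrite mul1r (ger0_norm (sqrtr_ge0 _)) gtr0_norm.
have k_le_n : 16 * k n <= n%:R.
  rewrite -[leRHS](sqr_sqrtr (ltW n_gt0)) expr2.
  apply: ler_pM => //; first exact: ltW.
  have -> : 16 = Num.sqrt (16 ^+ 2) :> R by rewrite sqrtr_sqr ger0_norm.
  by apply: ler_wsqrtr; rewrite -natrX ler_nat.
have T_gt0 : (0 < #|T|)%N by rewrite cardT; lia.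
have le_m : (16 * #|T| <= #|edges e|)%N.
  rewrite -(ler_nat R) cardT; apply: le_trans m_large.
  by rewrite natrM ler_pdivlMr // expr2 -mulrA (mulrC n%:R) mulrA ler_pM2r.
have [F [connF]] := connected_edge_set e_simple T_gt0 le_m.
rewrite cardT -(ler_nat R) !natrX 2!natrM natrX => le_F.
exists F; split=> //.
set M : R := #|edges e|%:R in m_large le_F.
set N : R := n%:R in n_gt0 m_large le_F *.
set K := k n in k_gt0 m_large *.
(* The left side is [N ^+ 6 / K ^+ 3]; dividing by [512 * N ^+ 4] leaves the claimed bound. *)
have le_cube : (N ^+ 2 / K) ^+ 3 <= 512 * N ^+ 4 * #|F|%:R.
  apply: le_trans le_F; apply: lerXn2r => //; rewrite nnegrE.
    by rewrite divr_ge0 ?exprn_ge0 ?ltW.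
  exact: ler0n.
rewrite -(ler_pM2l (_ : 0 < 512 * N ^+ 4)) ?mulr_gt0 ?exprn_gt0 //.
apply: le_trans le_cube; rewrite le_eqVlt; apply/orP; left; apply/eqP.
by field; rewrite gt_eqF.
Qed.
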